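(* Let $u$ be a single-rooted minimal $\mathbf{C}^\infty$-word of height $k>0$ and let $U\in\Sigma^k$ be its left frontier. Then $u$ is a prefix of each of the following three $\mathbf{C}^\infty$-words of height $k+1$: the single-rooted minimal word with left frontier $U1$ (the right $1$-extension of $u$), the single-rooted minimal word with left frontier $U2$ (the right $2$-extension of $u$), and the shortest $\mathbf{C}^\infty$-word with left frontier $U0$ (the right $0$-extension of $u$), which is single-rooted and not minimal. Moreover, the minimal part of the right $0$-extension of $u$ is the single-rooted minimal word whose left frontier is $\Theta(U)2$.
   Context: Let $\Sigma=\{1,2\}$, $\Sigma_0=\{0,1,2\}$; $w[i]$ is the $(i+1)$-th letter of $w$, $\tilde w$ the reversal; juxtaposition denotes concatenation. For $w=x_1^{i_1}\cdots x_n^{i_n}$ over $\Sigma$ (maximal runs), $\Delta(w)=i_1\cdots i_n$. The derivative: $D(\epsilon)=\epsilon$, otherwise (when $\Delta(w)$ is over $\Sigma$) $D(w)$ is $\Delta(w)$ with its first symbol deleted if it is $1$ and its last symbol deleted if it is $1$. $\mathbf{C}^{\infty}$ is the set of words with $D^j(w)$ defined for all $j$. Height: least $k$ with $D^k(w)=\epsilon$; root: $D^{k-1}(w)$; single-/double-rooted if the root has length one/two. A primitive of $w$ is $w'$ with $D(w')=w$. $w\in\mathbf{C}^{\infty}$ of height $k>1$ is minimal if for each $0\le j\le k-2$, $D^j(w)$ is a primitive of $D^{j+1}(w)$ of minimal length among all its primitives; words of height $1$ are minimal. Left frontier of $w$ of height $k>0$: the word $\Psi(w)$ of length $k$ over $\Sigma_0$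 with $\Psi(w)[0]=w[0]$ and for $0<i<k$, $\Psi(w)[i]=0$ if $D^i(w)[0]=2$ and $D^{i-1}(w)[0]\ne D^{i-1}(w)[1]$, else $\Psi(w)[i]=D^i(w)[0]$. Right frontier: $\Psi(\tilde w)$. Each $U\in\Sigma^*$ is the left frontier of a unique single-rooted minimal word and of a unique double-rooted minimal word; $\Gamma_s(U)$ (resp. $\Gamma_d(U)$) is the right frontier of the single-rooted (resp. double-rooted) minimal word with left frontier $U$, and $\Theta=\Gamma_s\circ\Gamma_d$. Every $w\in\mathbf{C}^\infty$ of height $k>0$ contains a factor that is a single-rooted minimal word of height $k$; the minimal part of $w$ is the first (leftmost occurring) such factor. *)

(* Defs.v *)
From mathcomp Require Import all_boot.

Set Implicit Arguments.
Unset Strict Implicit.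
Unset Printing Implicit Defensive.

(* Words over {1,2} and over {0,1,2} share the type [seq nat], since the letters
   of the derivative are the run lengths of a word; [over_Sigma] singles out the
   words over {1,2}. *)
Notation word := (seq nat).

Definition over_Sigma (w : word) : bool := all (fun x => (x == 1) || (x == 2)) w.

(* Lengths of the maximal runs. *)
Fixpoint Delta (w : word) : word :=
  if w is x :: w' then
    if ohead w' == Some x then incr_nth (Delta w') 0 else 1 :: Delta w'
  else [::].

Definition strip_first1 (s : word) : word :=
  if ohead s == Some 1 then behead s else s.

Definition strip_last1 (s : word) : word := rev (strip_first1 (rev s)).

(* [None] when the derivative is undefined. *)
Definition D (w : word) : option word :=
  if over_Sigma (Delta w) then Some (strip_last1 (strip_first1 (Delta w)))
  else None.

Definition Dn (j : nat) (w : word) : option word := iter j (obind D) (Some w).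

(* Total version of [Dn]; the value [[::]] is junk when [Dn j w] is [None]. *)
Definition Dw (j : nat) (w : word) : word := odflt [::] (Dn j w).

Definition Cinf (w : word) : Prop := over_Sigma w /\ forall j, Dn j w <> None.

(* Least k such that D^k(w) is empty. Searching up to [size w] suffices because
   D strictly shortens nonempty words, see [heightP]; the value is junk for
   words outside C^infinity. *)
Definition height (w : word) : nat :=
  find (fun k => Dn k w == Some [::]) (iota 0 (size w).+1).

Definition root_word (w : word) : word := Dw (height w).-1 w.

Definition single_rooted (w : word) : Prop :=
  [/\ Cinf w, 0 < height w & size (root_word w) = 1].

Definition double_rooted (w : word) : Prop :=
  [/\ Cinf w, 0 < height w & size (root_word w) = 2].

Definition primitive (w' w : word) : Prop := over_Sigma w' /\ D w' = Some w.

(* For words of height 1 the last condition is void. *)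
Definition minimal (w : word) : Prop :=
  [/\ Cinf w, 0 < height w &
    forall j, j.+1 < height w ->
      primitive (Dw j w) (Dw j.+1 w) /\
      forall p, primitive p (Dw j.+1 w) -> size (Dw j w) <= size p].

Definition Psi_letter (w : word) (i : nat) : nat :=
  if i is i'.+1 then
    if (nth 0 (Dw i w) 0 == 2) && (nth 0 (Dw i' w) 0 != nth 0 (Dw i' w) 1)
    then 0 else nth 0 (Dw i w) 0
  else nth 0 w 0.

(* Left frontier; the right frontier of w is [Psi (rev w)]. *)
Definition Psi (w : word) : word := mkseq (Psi_letter w) (height w).

(* Definite descriptions are rendered by [unique P x]: x satisfies P and is the
   only one to do so. *)
Definition is_single_minimal (U w : word) : Prop :=
  unique (fun v => [/\ single_rooted v, minimal v & Psi v = U]) w.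

Definition is_double_minimal (U w : word) : Prop :=
  unique (fun v => [/\ double_rooted v, minimal v & Psi v = U]) w.

Definition is_shortest (U w : word) : Prop :=
  unique (fun v => [/\ Cinf v, Psi v = U &
    forall v', Cinf v' -> Psi v' = U -> size v <= size v']) w.

(* Gamma_s, Gamma_d and Theta, as graphs of functions. *)
Definition is_Gamma_s (U V : word) : Prop :=
  exists2 w, is_single_minimal U w & V = Psi (rev w).

Definition is_Gamma_d (U V : word) : Prop :=
  exists2 w, is_double_minimal U w & V = Psi (rev w).

Definition is_Theta (U V : word) : Prop :=
  exists2 W, is_Gamma_d U W & is_Gamma_s W V.

Definition occurs_at (i : nat) (m w : word) : bool := prefix m (drop i w).

Definition minimal_factor_at (w : word) (i : nat) (m : word) : Prop :=
  [/\ single_rooted m, minimal m, height m = height w & occurs_at i m w].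

Definition is_minimal_part (w m : word) : Prop :=
  unique (fun m' => exists2 i, minimal_factor_at w i m' &
    forall j m'', minimal_factor_at w j m'' -> i <= j) m.

Lemma sumn_Delta w : sumn (Delta w) = size w.
Proof.
elim: w => //= x w IH; case: ifP => _ /=; last by rewrite IH add1n.
by rewrite -IH; case: (Delta w).
Qed.

Lemma size_leq_sumn s : over_Sigma s -> size s <= sumn s.
Proof.
elim: s => //= x s IH /andP[hx /IH h].
by rewrite -add1n leq_add //; case/orP: hx => /eqP->.
Qed.

Lemma size_D w v : D w = Some v -> 0 < size w -> size v < size w.
Proof.
rewrite /D; case: ifP => // hD [<-] hw.
have hl s : size (strip_last1 s) <= size s.
  rewrite /strip_last1 size_rev /strip_first1 -(size_rev s).
  by case: ifP => // _; rewrite size_behead leq_pred.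
apply: leq_ltn_trans (hl _) _; move: hD hw; rewrite -sumn_Delta.
case: (Delta w) => //= a r /andP[ha hr] _; rewrite /strip_first1 /=.
have hs := size_leq_sumn hr.
by case/orP: ha => /eqP -> /=; rewrite ?add1n ?add2n ltnS ?ltnS.
Qed.

Lemma size_Dw w : Cinf w -> forall j, size (Dw j w) <= size w - j.
Proof.
move=> [_ hw]; elim=> [|j IH]; first by rewrite subn0.
move: (hw j.+1) IH; rewrite /Dw /Dn iterS.
case: (iter j _ _) => //= v; case E: (D v) => [v'|] //= _ IH.
case: v E IH => [|x v] E IH; first by case: E => <-.
by rewrite subnS -ltnS; apply: leq_trans (size_D E isT) (leq_trans IH (leqSpred _)).
Qed.

Lemma heightP w : Cinf w ->
  Dn (height w) w = Some [::] /\ forall j, j < height w -> Dn j w <> Some [::].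
Proof.
move=> hw.
have hE : Dn (size w) w == Some [::].
  move: (size_Dw hw (size w)) (hw.2 (size w)); rewrite /Dw subnn.
  by case: (Dn _ w) => //= v; rewrite leqn0 size_eq0 => /eqP->.
have hh : has (fun k => Dn k w == Some [::]) (iota 0 (size w).+1).
  by apply/hasP; exists (size w); rewrite // mem_iota /= add0n ltnS.
have hb : height w < (size w).+1 by move: hh; rewrite has_find size_iota.
split.
  by have /eqP := nth_find 0 hh; rewrite nth_iota.
move=> j hj; have := before_find 0 hj.
by rewrite nth_iota ?add0n; [move/eqP | apply: ltn_trans hj hb].
Qed.

(* Main.v *)
(* A minimal word of height [k] is obtained from its root by [k - 1] minimal
   primitives, the choices of whose first letters spell its left frontier. If
   [w] has the same nonzero letters on its left frontier, applying the minimal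
   primitives to a prefix of [D^j(w)] yields a prefix of [w]. At level [k - 1]
   let [u] be [x], and let [y] be the other letter: then the three extensions of
   [u] are [xyx], [xx] and [xyy], all starting with [x].
   For the minimal part of the 0-extension [xyy], look at the middle [y]. The
   double-rooted word lifting [xy] (left frontier [U]) and the word [m] lifting
   the suffix [yy] overlap in the single-rooted word lifting this [y], whose
   right frontier is that of [xy], namely [Gamma_d U]; hence its left frontier is
   [Theta U], and that of [m] is [Theta U] followed by 2. Since the 0-extension
   has no 0 in its right frontier, any suffix of it starting with a minimal
   factor of full height is itself minimal, so it is [m]. *)
Require Import Defs.
From mathcomp Require Import all_boot.

Set Implicit Arguments.
Unset Strict Implicit.
Unset Printing Implicit Defensive.

Definition letter (x : nat) : bool := (x == 1) || (x == 2).

Lemma letter_flip x : letter x -> letter (3 - x).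
Proof. by case/orP=> /eqP->. Qed.

Lemma flipK x : letter x -> 3 - (3 - x) = x.
Proof. by case/orP=> /eqP->. Qed.

Lemma flip_neq x : letter x -> (3 - x == x) = false.
Proof. by case/orP=> /eqP->. Qed.

Lemma letter_neq x y : letter x -> letter y -> x != y -> y = 3 - x.
Proof. by case/orP=> /eqP->; case/orP=> /eqP->. Qed.

(** * Words and their run lengths *)

(** Inverse of [Delta] once the first letter is fixed; [3 - x] exchanges the letters 1 and 2. *)
Fixpoint expand (x : nat) (s : word) : word :=
  if s is c :: s' then nseq c x ++ expand (3 - x) s' else [::].

Lemma expand_cat x s t :
  expand x (s ++ t) = expand x s ++ expand (iter (size s) (subn 3) x) t.
Proof. by elim: s x => //= c s IH x; rewrite IH catA -iterSr. Qed.

Lemma letter_iter n x : letter x -> letter (iter n (subn 3) x).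
Proof. by elim: n => //= n IH /IH/letter_flip. Qed.

Lemma over_Sigma_cons x s : over_Sigma (x :: s) = letter x && over_Sigma s.
Proof. by []. Qed.

Lemma over_Sigma_cat s t : over_Sigma (s ++ t) = over_Sigma s && over_Sigma t.
Proof. exact: all_cat. Qed.

Lemma over_Sigma_rev s : over_Sigma (rev s) = over_Sigma s.
Proof. exact: all_rev. Qed.

Lemma over_Sigma_expand x s : letter x -> over_Sigma (expand x s).
Proof.
elim: s x => //= c s IH x hx; rewrite over_Sigma_cat IH ?letter_flip // andbT.
by apply/allP=> y /nseqP[-> _].
Qed.

Lemma size_expand x s : size (expand x s) = sumn s.
Proof. by elim: s x => //= c s IH x; rewrite size_cat size_nseq IH. Qed.

Lemma ohead_expand x s :
  over_Sigma s -> ohead (expand x s) = if s is [::] then None else Some x.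
Proof. by case: s => //= c s /andP[/orP[]/eqP->]. Qed.

Lemma Delta_expand x s : letter x -> over_Sigma s -> Delta (expand x s) = s.
Proof.
elim: s x => //= c s IH x hx /andP[hc hs].
have h := ohead_expand (3 - x) hs; have hn := flip_neq hx.
have hI := IH _ (letter_flip hx) hs.
have h1 : ohead (expand (3 - x) s) == Some x = false.
  by rewrite h; case: (s) => //= *; apply: hn.
by case/orP: hc => /eqP->; rewrite /= ?eqxx /= h1 hI.
Qed.

Lemma DeltaK w : over_Sigma w -> expand (head 0 w) (Delta w) = w.
Proof.
elim: w => //= x w IH /andP[hx hw]; move: (IH hw).
case: w hw {IH} => [|z w] //= /andP[hz hw].
have -> : (Some z == Some x) = (z == x) by [].
case: (eqVneq z x) => [->|hzx] /= IH.
  by move: IH; case: ifP => _ /=; case: (Delta w) => //= *; congr (_ :: _).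
by rewrite eq_sym in hzx; rewrite -(letter_neq hx hz hzx) IH.
Qed.

(** The equation on [iter] tracks the letter that would continue the reversed word; the induction
    needs it to append one more run. *)
Lemma rev_expand x s : letter x ->
  exists y, [/\ letter y, rev (expand x s) = expand y (rev s)
              & iter (size s) (subn 3) y = 3 - x].
Proof.
elim: s x => [|c s IH] x hx; first by exists (3 - x); rewrite letter_flip.
have [y [hy e1 e2]] := IH _ (letter_flip hx); rewrite flipK // in e2.
exists y; split=> //=; last by rewrite e2.
rewrite rev_cat e1 rev_cons -cats1 expand_cat size_rev e2 /= cats0; congr (_ ++ _).
by rewrite rev_nseq.
Qed.

Lemma Delta_rev w : over_Sigma w -> over_Sigma (Delta w) ->
  Delta (rev w) = rev (Delta w).
Proof.
case: w => // x w hw hD; have hx : letter x by case/andP: hw.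
rewrite -{1}(DeltaK hw); have [y [hy -> _]] := rev_expand (Delta (x :: w)) hx.
by rewrite Delta_expand ?over_Sigma_rev.
Qed.

(** * Primitives and the derivative *)

(** Run lengths of a minimal primitive of a nonempty [v]: [D] would strip an end letter 1, so an
    extra 1 shields it, whereas an end letter 2 needs no shield. *)
Definition pad (v : word) : word :=
  nseq (head 0 v == 1) 1 ++ v ++ nseq (last 0 v == 1) 1.

Definition prim (x : nat) (v : word) : word := expand x (pad v).

Lemma over_Sigma_pad v : over_Sigma v -> over_Sigma (pad v).
Proof.
by move=> hv; rewrite /pad !over_Sigma_cat hv; do 2!case: (_ == 1).
Qed.

Lemma head_rev (v : word) : head 0 (rev v) = last 0 v.
Proof. by case/lastP: v => // t z; rewrite rev_rcons last_rcons. Qed.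

Lemma last_rev (v : word) : last 0 (rev v) = head 0 v.
Proof. by rewrite -head_rev revK. Qed.

Lemma rev_pad v : rev (pad v) = pad (rev v).
Proof.
by rewrite /pad !rev_cat !rev_nseq head_rev last_rev catA.
Qed.

Lemma strip_last1_rcons s c :
  strip_last1 (rcons s c) = if c == 1 then s else rcons s c.
Proof.
rewrite /strip_last1 rev_rcons /strip_first1 /=.
by case: eqP => [[->]|h]; case: eqP => // *; rewrite ?rev_cons revK //; case: h; congr Some.
Qed.

Lemma strip_cons c s :
  strip_first1 (c :: s) = if c == 1 then s else c :: s.
Proof. by []. Qed.

Lemma rev_strip s :
  strip_last1 (strip_first1 (rev s)) = rev (strip_last1 (strip_first1 s)).
Proof.
case: s => //= a s; case/lastP: s => [|s b]; first by case: a => [|[|a]].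
rewrite rev_cons rev_rcons !rcons_cons !strip_cons.
case hb: (b == 1); case ha: (a == 1); rewrite -?rcons_cons !strip_last1_rcons ?ha ?hb //.
- by rewrite rev_cons.
- by rewrite rev_rcons.
by rewrite rev_rcons rev_cons.
Qed.

Lemma over_Sigma_strip s :
  over_Sigma s -> over_Sigma (strip_last1 (strip_first1 s)).
Proof.
have h t : over_Sigma t -> over_Sigma (strip_first1 t).
  by case: t => //= c t; rewrite strip_cons => /andP[hc ht]; case: ifP => //=; rewrite ht hc.
by move=> hs; rewrite /strip_last1 over_Sigma_rev h // over_Sigma_rev h.
Qed.

Lemma over_Sigma_D w v : D w = Some v -> over_Sigma v.
Proof. by rewrite /D; case: ifP => // h [<-]; apply: over_Sigma_strip. Qed.

Lemma D_rev w v : over_Sigma w -> D w = Some v -> D (rev w) = Some (rev v).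
Proof.
rewrite /D => hw; case: ifP => // hD [<-].
by rewrite Delta_rev // over_Sigma_rev hD rev_strip.
Qed.

Lemma strip_pad v : v != [::] -> strip_last1 (strip_first1 (pad v)) = v.
Proof.
case: v => // x v _; rewrite /pad.
have -> : strip_first1 (nseq (head 0 (x :: v) == 1) 1 ++ (x :: v) ++
    nseq (last 0 (x :: v) == 1) 1) = (x :: v) ++ nseq (last 0 (x :: v) == 1) 1.
  by rewrite /=; case: (eqVneq x 1) => //= h; rewrite strip_cons (negPf h).
rewrite lastI last_rcons; case: (eqVneq _ 1) => h /=.
  by rewrite cats1 strip_last1_rcons.
by rewrite cats0 strip_last1_rcons (negPf h).
Qed.

Lemma D_prim x v : letter x -> over_Sigma v -> v != [::] -> D (prim x v) = Some v.
Proof.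
move=> hx hv v0.
by rewrite /D Delta_expand ?over_Sigma_pad // strip_pad.
Qed.

Lemma rev_prim x v : letter x -> exists2 y, letter y & rev (prim x v) = prim y (rev v).
Proof.
move=> hx; have [y [hy e _]] := rev_expand (pad v) hx.
by exists y; rewrite // /prim e rev_pad.
Qed.

(** A 1 deleted in front of a 1 is forced by the result; one deleted in front of a 2 is optional and
    is recorded by [a]. *)
Lemma strip_first1_inv s v : over_Sigma s -> strip_first1 s = v -> v != [::] ->
  exists a : bool, s = nseq a 1 ++ nseq (head 0 v == 1) 1 ++ v /\ (a -> head 0 v = 2).
Proof.
case: s => [|c s] /=; first by move=> _ <-.
rewrite strip_cons => /andP[hc hs]; case: eqP => [->|h1] <- // v0.
  case: s hs v0 => // d s /andP[/orP[]/eqP-> _] _; first by exists false.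
  by exists true.
by case/orP: hc h1 => /eqP -> // _; exists false.
Qed.

(* The flags [a] and [b] record an avoidable run of length 1 at the left and at
   the right end; they correspond to the letter 0 in the frontiers of [w]. *)
Lemma D_inv w v : D w = Some v -> v != [::] -> exists a b : bool,
  [/\ Delta w = nseq a 1 ++ pad v ++ nseq b 1, a -> head 0 v = 2 & b -> last 0 v = 2].
Proof.
rewrite /D; case: ifP => // hD [hv] v0.
set v1 := strip_first1 (Delta w) in hv.
have v10 : v1 != [::] by apply: contraNneq v0 => e; rewrite -hv e.
have [a [e1 ha]] := strip_first1_inv hD erefl v10; rewrite -/v1 in e1 ha.
have h1 : over_Sigma (rev v1).
  by rewrite over_Sigma_rev; move: hD; rewrite e1 !over_Sigma_cat => /and3P[].
have h2 : strip_first1 (rev v1) = rev v by rewrite -hv revK.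
have [|b [e2 hb]] := strip_first1_inv h1 h2.
  by apply: contraNneq v0 => e; rewrite -(revK v) e.
rewrite head_rev in e2 hb.
have e3 : v1 = v ++ nseq (last 0 v == 1) 1 ++ nseq b 1.
  by rewrite -(revK v1) e2 !rev_cat revK !rev_nseq catA.
have e4 : head 0 v1 = head 0 v by rewrite e3; case: (v) v0.
exists a, b; rewrite -e4; split=> //.
by rewrite e1 {2}e3 e4 /pad !catA.
Qed.

Lemma size_prim_leq x p v : D p = Some v -> v != [::] -> size (prim x v) <= size p.
Proof.
move=> hD v0; have [a [b [e _ _]]] := D_inv hD v0.
rewrite size_expand -(sumn_Delta p) e; move: (pad v) => s.
by rewrite !sumn_cat addnCA leq_addr.
Qed.

(** Each flag of [D_inv] costs one letter, so a primitive no longer than [prim] has none. *)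
Lemma prim_shortest x p v : over_Sigma p -> D p = Some v -> v != [::] ->
  size p <= size (prim x v) -> p = prim (head 0 p) v.
Proof.
move=> hp hD v0; have [a [b [e _ _]]] := D_inv hD v0.
rewrite size_expand -(sumn_Delta p) -{2}(DeltaK hp) /prim e.
move: (pad v) => s; rewrite !sumn_cat !sumn_nseq !mul1n addnCA.
rewrite -{2}(addn0 (sumn s)) leq_add2l leqn0 addn_eq0 !eqb0.
by move=> /andP[/negPf-> /negPf->]; rewrite cats0.
Qed.

Lemma head_pad v : head 0 v = 2 -> pad v = 2 :: behead (pad v).
Proof. by rewrite /pad; case: v => //= x v ->. Qed.

(** An avoidable first run of length 1 would make the first two letters of [w] differ. *)
Lemma D_inv_left w v : over_Sigma w -> D w = Some v -> v != [::] ->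
  (head 0 v = 2 -> nth 0 w 0 = nth 0 w 1) ->
  exists b : bool, Delta w = pad v ++ nseq b 1 /\ (b -> last 0 v = 2).
Proof.
move=> hw hD v0 hs; have [a [b [e ha hb]]] := D_inv hD v0.
exists b; split=> //; case: a ha e => // /(_ isT) h2.
rewrite (head_pad h2) => e; move: (hs h2); rewrite -(DeltaK hw) e /= => h.
have hx : letter (head 0 w) by case: (w) hw e => //= x t /andP[].
by move: (flip_neq hx); rewrite -h eqxx.
Qed.

Lemma prim_prefix w v v' : over_Sigma w -> D w = Some v' -> prefix v v' ->
  v != [::] -> (head 0 v = 2 -> nth 0 w 0 = nth 0 w 1) ->
  prefix (prim (head 0 w) v) w.
Proof.
move=> hw hD /prefixP[z e] v0 hs; have hv' := over_Sigma_D hD.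
have eh : head 0 v' = head 0 v by rewrite e; case: (v) v0.
have v'0 : v' != [::] by rewrite e; case: (v) v0.
rewrite -eh in hs; have [b [eD _]] := D_inv_left hw hD v'0 hs.
have eP : pad v' ++ nseq b 1 =
    nseq (head 0 v == 1) 1 ++ v ++ (z ++ nseq (last 0 v' == 1) 1 ++ nseq b 1).
  by rewrite (catA v) -e /pad eh -!catA.
rewrite -{2}(DeltaK hw) eD eP /prim /pad expand_cat [in X in prefix _ X]expand_cat.
rewrite prefix_catr // eqxx /= expand_cat [in X in prefix _ X]expand_cat.
rewrite prefix_catr // eqxx /=.
(* Only the shielding 1 at the end of [pad v] remains. If [v] is all of [v'], then [pad v'] has the
   same 1; otherwise it is covered by the next run of [w], which has length at least 1. *)
clear eP; case h1 : (last 0 v == 1); last exact: prefix0s.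
case: z e => [|c z] e; first by rewrite e cats0 h1 /= eqxx prefix0s.
by move: hv'; rewrite e over_Sigma_cat => /andP[_ /andP[/orP[]/eqP->]] /=; rewrite eqxx ?prefix0s.
Qed.

(** Both flags of [D_inv] vanish: the left one by [D_inv_left], the right one by [D_inv_left] for
    the reversal, whose runs would otherwise begin with 1 instead of 2. *)
Lemma prim_tight w v : over_Sigma w -> D w = Some v -> v != [::] ->
  (head 0 v = 2 -> nth 0 w 0 = nth 0 w 1) ->
  (last 0 v = 2 -> nth 0 (rev w) 0 = nth 0 (rev w) 1) ->
  w = prim (head 0 w) v.
Proof.
move=> hw hD v0 hl hr; have [b [e hb]] := D_inv_left hw hD v0 hl.
rewrite -{1}(DeltaK hw) e; case: b hb e => [/(_ isT) h2 e|_ e]; last by rewrite cats0.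
have rv0 : rev v != [::] by apply: contraNneq v0 => e'; rewrite -(revK v) e'.
have hrw : over_Sigma (rev w) by rewrite over_Sigma_rev.
rewrite -(head_rev v) in h2 hr.
have [b' [e' _]] := D_inv_left hrw (D_rev hw hD) rv0 hr.
have hDw : over_Sigma (Delta w) by move: hD; rewrite /D; case: ifP.
move: e'; rewrite Delta_rev // e rev_cat rev_pad (head_pad h2).
by case.
Qed.

(** * Derivatives of prefixes *)

Lemma Delta_cons2 x y w : Delta [:: x, y & w] =
  if y == x then incr_nth (Delta (y :: w)) 0 else 1 :: Delta (y :: w).
Proof. by []. Qed.

Lemma Delta_prefix p w : prefix p w -> p != [::] ->
  exists t c c' t', [/\ Delta p = rcons t c, Delta w = t ++ c' :: t' & 0 < c <= c'].
Proof.
case/prefixP=> q ->; elim: p q => // x [|y p] IH q _.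
  exists [::], 1; case: q => [|y q]; first by exists 1, [::].
  rewrite cat1s Delta_cons2; case: ifP => _; last by exists 1, (Delta (y :: q)).
  by case: (Delta (y :: q)) => [|c s]; [exists 1, [::] | exists c.+1, s].
have [t [c [c' [t' [e1 e2 hc]]]]] := IH q isT.
rewrite !cat_cons in e2 *; rewrite !Delta_cons2 e1 e2.
case: ifP => _; last by exists (1 :: t), c, c', t'.
case: t {e1 e2} => [|d t]; first by exists [::], c.+1, c'.+1, t'; case/andP: hc.
by exists (d.+1 :: t), c, c', t'.
Qed.

Lemma prefix_strip_last1 t s : prefix t (strip_last1 (t ++ s)) || (s == [::]).
Proof.
case/lastP: s => [|s c]; first by rewrite eqxx orbT.
rewrite -rcons_cat strip_last1_rcons; case: ifP => _.
  by rewrite prefix_prefix.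
by rewrite -cats1 -catA prefix_prefix.
Qed.

(** Only the last run of [p] can be a truncated run of [w]. If its length is 1, it is deleted; if it
    is 2, it is a complete run. *)
Lemma D_prefix p w v : prefix p w -> D w = Some v ->
  exists2 v', D p = Some v' & prefix v' v.
Proof.
case: (eqVneq p [::]) => [-> _ _|p0 hp]; first by exists [::]; last exact: prefix0s.
have [t [c [c' [t' [e1 e2 hc]]]]] := Delta_prefix hp p0.
rewrite /D e1 e2; case: ifP => //.
rewrite over_Sigma_cat => /and3P[ht hc' ht'] [<-].
have -> : over_Sigma (rcons t c).
  rewrite -cats1 over_Sigma_cat ht /= andbT.
  by case: c c' hc hc' {e1 e2} => [|[|[|c]]] [|[|[|c']]].
eexists; first by [].
have hc1 : c != 1 -> c' = c /\ c = 2.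
  by case: c c' hc hc' {e1 e2} => [|[|[|c]]] [|[|[|c']]].
(* With [t] empty, [p] is a single run, first and last at once. *)
case: t ht {e1 e2} => [|d t] ht.
  rewrite /= strip_cons; case: (eqVneq c 1) hc1 => [_ _|_ /(_ isT)[-> ->]].
    exact: prefix0s.
  by have := prefix_strip_last1 [:: 2] t'; case: t' {ht'} => [|e t']; rewrite ?orbF.
rewrite cat_cons rcons_cons !strip_cons.
set t1 := if d == 1 then t else d :: t.
have -> : (if d == 1 then rcons t c else d :: rcons t c) = rcons t1 c.
  by rewrite /t1; case: ifP.
have -> : (if d == 1 then t ++ c' :: t' else d :: t ++ c' :: t') = t1 ++ c' :: t'.
  by rewrite /t1; case: ifP.
rewrite strip_last1_rcons; case: (eqVneq c 1) hc1 => [_ _|_ /(_ isT)[-> ->]].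
  by have := prefix_strip_last1 t1 (c' :: t'); rewrite orbF.
rewrite -cat_rcons.
have := prefix_strip_last1 (rcons t1 2) t'; case: t' {ht'} => [|e t']; rewrite ?orbF //.
by rewrite cats0 strip_last1_rcons prefix_refl.
Qed.

(** * Iterated derivatives, heights and frontiers *)

Lemma Dn_S j w v : D w = Some v -> Dn j.+1 w = Dn j v.
Proof. by rewrite /Dn iterSr /= => ->. Qed.

Lemma Dw_S j w v : D w = Some v -> Dw j.+1 w = Dw j v.
Proof. by move=> h; rewrite /Dw (Dn_S _ h). Qed.

Lemma Dn_nil j : Dn j [::] = Some [::].
Proof. by elim: j => // j IH; rewrite (@Dn_S _ _ [::]). Qed.

Lemma Dw_nil j : Dw j [::] = [::].
Proof. by rewrite /Dw Dn_nil. Qed.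

Lemma Cinf_nil : Cinf [::].
Proof. by split=> // j; rewrite Dn_nil. Qed.

Lemma Cinf_Sigma w : Cinf w -> over_Sigma w.
Proof. by case. Qed.

Lemma Cinf_S w v : over_Sigma w -> D w = Some v -> Cinf v -> Cinf w.
Proof. by move=> hw hD [_ hv]; split=> // -[|j] //; rewrite (Dn_S _ hD). Qed.

Lemma Cinf_Dn w j : Cinf w -> Dn j w = Some (Dw j w).
Proof. by case=> _ /(_ j); rewrite /Dw; case: (Dn j w). Qed.

Lemma Cinf_D w : Cinf w -> D w = Some (Dw 1 w).
Proof. by move=> hw; rewrite -Cinf_Dn. Qed.

Lemma Dn_add i j w : Cinf w -> Dn (i + j) w = Dn i (Dw j w).
Proof. by move=> hw; rewrite {1}/Dn iterD -/(Dn j w) Cinf_Dn. Qed.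

Lemma D_Dw j w : Cinf w -> D (Dw j w) = Some (Dw j.+1 w).
Proof. by move=> hw; rewrite -[D _]/(Dn 1 (Dw j w)) -Dn_add // add1n Cinf_Dn. Qed.

Lemma Dw_add i j w : Cinf w -> Dw (i + j) w = Dw i (Dw j w).
Proof. by move=> hw; rewrite /Dw Dn_add. Qed.

Lemma Cinf_Dw w j : Cinf w -> Cinf (Dw j w).
Proof.
move=> hw; split; last by move=> i; rewrite -Dn_add //; case: hw.
elim: j => [|j IH]; first exact: Cinf_Sigma.
apply: (@over_Sigma_D (Dw j w)).
by rewrite D_Dw.
Qed.

Lemma Cinf_prefix p w : Cinf w -> prefix p w ->
  Cinf p /\ forall j, prefix (Dw j p) (Dw j w).
Proof.
move=> hw hp.
have h j : exists2 v, Dn j p = Some v & prefix v (Dw j w).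
  elim: j => [|j [v e h]]; first by exists p.
  have [v' e' h'] := D_prefix h (D_Dw j hw).
  by exists v' => //; rewrite /Dn iterS -/(Dn j p) e.
split; last by move=> j; have [v e] := h j; rewrite {2}/Dw e.
split; last by move=> j; have [v ->] := h j.
by case/prefixP: hp => q e; case/Cinf_Sigma: hw; rewrite e over_Sigma_cat => /andP[].
Qed.

Lemma Cinf_rev w : Cinf w -> Cinf (rev w) /\ forall j, Dw j (rev w) = rev (Dw j w).
Proof.
move=> hw; have h j : Dn j (rev w) = Some (rev (Dw j w)).
  elim: j => // j IH; rewrite /Dn iterS -/(Dn j (rev w)) IH /=.
  apply: D_rev; first exact/Cinf_Sigma/Cinf_Dw.
  by rewrite D_Dw.
split; last by move=> j; rewrite {1}/Dw h.
by split; [rewrite over_Sigma_rev; apply: Cinf_Sigma | move=> j; rewrite h].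
Qed.

Lemma height_ltn w j : Cinf w -> (j < height w) = (Dw j w != [::]).
Proof.
move=> hw; have [h1 h2] := heightP hw; case: ltnP => hj.
  by apply/esym/eqP=> e; apply: (h2 j hj); rewrite Cinf_Dn // e.
rewrite -(subnK hj) Dw_add // [Dw (height w) w]/Dw h1 /=.
by rewrite Dw_nil.
Qed.

Lemma height_eq w k : Cinf w -> (forall j, (j < k) = (Dw j w != [::])) -> height w = k.
Proof.
move=> hw h; apply/eqP; rewrite eqn_leq leqNgt [k <= _]leqNgt.
by rewrite height_ltn // -h ltnn h -height_ltn // ltnn.
Qed.

Lemma height_S w v : Cinf w -> D w = Some v -> w != [::] -> height w = (height v).+1.
Proof.
move=> hw hD w0; apply: height_eq => // -[|j]; first by rewrite w0.
have hv : Cinf v.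
  have := Cinf_Dw 1 hw; rewrite (Dw_S _ hD) //.
by rewrite ltnS (Dw_S _ hD) height_ltn.
Qed.

Lemma size_Psi w : size (Psi w) = height w.
Proof. exact: size_mkseq. Qed.

Lemma nth_Psi w i : i < height w -> nth 0 (Psi w) i = Psi_letter w i.
Proof. exact: nth_mkseq. Qed.

Lemma Psi_letter_S w v i : D w = Some v -> Psi_letter w i.+2 = Psi_letter v i.+1.
Proof. by move=> hD; rewrite /Psi_letter !(Dw_S _ hD). Qed.

Lemma Psi_letter_1 w v : D w = Some v -> Psi_letter w 1 =
  if (nth 0 v 0 == 2) && (nth 0 w 0 != nth 0 w 1) then 0 else nth 0 v 0.
Proof. by move=> hD; rewrite /Psi_letter !(Dw_S _ hD). Qed.

Lemma Psi_letter_Dw w i j : Cinf w -> Psi_letter (Dw j w) i.+1 = Psi_letter w (i + j).+1.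
Proof. by move=> hw; rewrite /Psi_letter -addSn !Dw_add. Qed.

Lemma size_gt1_D w v : D w = Some v -> v != [::] -> 1 < size w.
Proof.
move=> hD; case: v hD => // c v hD _.
have := size_D hD; case: w hD => [|x w] hD; first by case: hD.
by move=> /(_ isT); apply: leq_trans.
Qed.

Lemma Psi_letter_prefix w p i : Cinf w -> prefix p w -> Dw i p != [::] ->
  Psi_letter p i = Psi_letter w i.
Proof.
move=> hw hp; have [hCp h] := Cinf_prefix hw hp.
have hn j n : n < size (Dw j p) -> nth 0 (Dw j w) n = nth 0 (Dw j p) n.
  by case/prefixP: (h j) => q -> hn; rewrite nth_cat hn.
case: i => [|i] h0; first by rewrite /= (hn 0 0) //; case: (p) h0.
(* The test for 0 reads two letters at level [i]; both lie inside the prefix, because its next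
   derivative is nonempty. *)
have h1 : 1 < size (Dw i p).
  by apply: size_gt1_D h0; rewrite D_Dw.
rewrite /Psi_letter !(hn i) // 1?ltnW // (hn i.+1) //.
by case: (Dw i.+1 p) h0.
Qed.

Lemma Psi_prefix w p : Cinf w -> prefix p w -> height p = height w -> Psi p = Psi w.
Proof.
move=> hw hp e; have [hCp _] := Cinf_prefix hw hp.
apply: (@eq_from_nth _ 0); rewrite !size_Psi // => i hi.
by rewrite !nth_Psi -?e // (Psi_letter_prefix hw hp) // -height_ltn.
Qed.

Lemma prim_neq0 x v : letter x -> over_Sigma v -> v != [::] -> prim x v != [::].
Proof.
move=> hx hv v0; apply/eqP => e; have := D_prim hx hv v0.
by rewrite e => -[ev]; rewrite -ev in v0.
Qed.

Lemma head_prim x v : letter x -> over_Sigma v -> v != [::] -> head 0 (prim x v) = x.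
Proof.
by move=> hx; case: v => // c v /andP[/orP[]/eqP-> _] _.
Qed.

Lemma Cinf_prim x v : letter x -> Cinf v -> v != [::] -> Cinf (prim x v).
Proof.
move=> hx hv v0; apply: (Cinf_S _ _ hv); first exact: over_Sigma_expand.
exact: D_prim (Cinf_Sigma hv) v0.
Qed.

Lemma Psi_prim x v : letter x -> Cinf v -> v != [::] -> Psi (prim x v) = x :: Psi v.
Proof.
move=> hx hv v0; have hw := Cinf_prim hx hv v0; have hS := Cinf_Sigma hv.
have hD := D_prim hx hS v0.
have hh := height_S hw hD (prim_neq0 hx hS v0).
apply: (@eq_from_nth _ 0); rewrite /= !size_Psi // hh => -[|[|i]] hi.
- by rewrite nth_Psi ?hh //= nth0 head_prim.
- rewrite nth_Psi ?hh // (Psi_letter_1 hD) /= nth_Psi //= ifN //.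
  (* If [v] begins with 2, the first run of [prim x v] has length 2, so its first two letters agree
     and no 0 arises. *)
  rewrite negb_and negbK; case: eqP => // e.
  rewrite nth0 in e; rewrite /prim (head_pad e) /=.
  exact: eqxx.
by rewrite nth_Psi ?hh // (Psi_letter_S _ hD) /= nth_Psi.
Qed.

(** * Iterated minimal primitives *)

(** [V] lists the first letters of the derivatives of orders 0 to [size V - 1], and [v] is the
    derivative of order [size V]. *)
Definition prims (V v : word) : word := foldr prim v V.

Lemma primsP V v : over_Sigma V -> Cinf v -> v != [::] ->
  [/\ Cinf (prims V v), prims V v != [::], Dw (size V) (prims V v) = v,
      Psi (prims V v) = V ++ Psi v & height (prims V v) = size V + height v].
Proof.
move=> hV hv v0; elim: V hV => //= x V IH /andP[hx /IH [h1 h2 h3 h4 h5]].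
have hD := D_prim hx (Cinf_Sigma h1) h2.
have h6 := prim_neq0 hx (Cinf_Sigma h1) h2; have h7 := Cinf_prim hx h1 h2.
by rewrite (Dw_S _ hD) Psi_prim // h4 (height_S h7 hD) // h5.
Qed.

(** Since [pad] commutes with reversal, a reversed minimal primitive is again one. Right frontiers
    of iterated primitives are computed through this. *)
Lemma rev_prims V v : over_Sigma V ->
  exists2 V', over_Sigma V' && (size V' == size V) & rev (prims V v) = prims V' (rev v).
Proof.
elim: V => [|x V IH] /=; first by exists [::].
case/andP=> hx /IH[V' /andP[h1 h2] e].
have [y hy e'] := rev_prim (prims V v) hx.
exists (y :: V'); last by rewrite /= e' e.
by rewrite over_Sigma_cons hy h1 /= eqSS.
Qed.

(** The larger word is built from minimal primitives too, so the condition of [prim_prefix] on its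
    first two letters is automatic. *)
Lemma prims_mono V v v' : over_Sigma V -> Cinf v' -> prefix v v' -> v != [::] ->
  prefix (prims V v) (prims V v').
Proof.
move=> hV hv' hp v0; have hv : Cinf v by case: (Cinf_prefix hv' hp).
have v'0 : v' != [::] by case/prefixP: hp => q ->; case: (v) v0.
elim: V hV => //= x V IH /andP[hx hV].
have [h1 h2 _ _ _] := primsP hV hv' v'0; have hS := Cinf_Sigma h1.
have [_ h3 _ _ _] := primsP hV hv v0.
rewrite -{1}(head_prim hx hS h2); apply: (prim_prefix _ _ (IH hV) h3).
- exact: over_Sigma_expand.
- exact: D_prim.
move=> e; have e2 : head 0 (prims V v') = 2.
  by case/prefixP: (IH hV) => q ->; case: (prims V v) h3 e.
by rewrite /prim (head_pad e2).
Qed.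

(** Nonzero frontier letters up to level [size V] exclude avoidable runs at the left end, so
    [prim_prefix] applies at every level, even if [w] is not built from minimal primitives. *)
Lemma prims_prefix V w v : over_Sigma V -> Cinf w -> prefix v (Dw (size V) w) ->
  v != [::] -> (forall j, j < size V -> Psi_letter w j = nth 0 V j) ->
  Psi_letter w (size V) != 0 -> prefix (prims V v) w.
Proof.
elim: V w => [|x V IH] w //= /andP[hx hV] hw hp v0 hj hs.
have hD := Cinf_D hw; set w1 := Dw 1 w in hD; have hw1 : Cinf w1 by apply: Cinf_Dw.
rewrite (Dw_S _ hD) in hp.
have d0 : Dw (size V) w1 != [::] by case/prefixP: hp => q ->; case: (v) v0.
have w10 : w1 != [::] by apply: contraNneq d0 => ->; rewrite Dw_nil.
have n1 : Psi_letter w 1 != 0.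
  (* The letter at index 1 belongs to [V] if one is left, and is otherwise the letter at level
     [size V]. *)
  case: (V) hV hj hs => //= y V' /andP[hy _] /(_ 1 isT) /= -> _.
  by case/orP: hy => /eqP->.
have hs1 : ~~ ((nth 0 w1 0 == 2) && (nth 0 w 0 != nth 0 w 1)).
  by move: n1; rewrite (Psi_letter_1 hD); case: ifP.
have e0 : Psi_letter w 1 = nth 0 w1 0 by rewrite (Psi_letter_1 hD) ifN.
have eS i : Psi_letter w1 i = Psi_letter w i.+1.
  by case: i => [|i]; rewrite ?e0 // (Psi_letter_S _ hD).
have hI : prefix (prims V v) w1.
  apply: IH => //; last by rewrite eS.
  by move=> j hjV; rewrite eS hj.
have p0 : prims V v != [::].
  case: (V) hV hI => //= y V' /andP[hy hV'] hI.
  have [hC _] := Cinf_prefix (Cinf_Dw (size V) hw1) hp.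
  have [h1 h2 _ _ _] := primsP hV' hC v0.
  exact: prim_neq0 (Cinf_Sigma h1) h2.
have -> : x = head 0 w by rewrite -nth0 -[LHS]/(nth 0 (x :: V) 0) -hj.
apply: (prim_prefix _ hD hI p0); first exact: Cinf_Sigma.
move=> e; have e2 : nth 0 w1 0 = 2.
  by case/prefixP: hI => q ->; case: (prims V v) p0 e.
by move: hs1; rewrite e2 /= negbK => /eqP.
Qed.

(** Without 0 in either frontier up to level [n], [prim_tight] applies at each of these levels. *)
Lemma prims_tight n w : Cinf w -> Dw n w != [::] ->
  (forall i, i <= n -> Psi_letter w i != 0) ->
  (forall i, i <= n -> Psi_letter (rev w) i != 0) ->
  exists2 V, over_Sigma V && (size V == n) & w = prims V (Dw n w).
Proof.
elim: n w => [|n IH] w hw d0 hl hr; first by exists [::].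
have hD := Cinf_D hw; set w1 := Dw 1 w in hD; have hw1 : Cinf w1 by apply: Cinf_Dw.
rewrite (Dw_S _ hD) in d0 *.
have w10 : w1 != [::] by apply: contraNneq d0 => ->; rewrite Dw_nil.
have hDr := D_rev (Cinf_Sigma hw) hD.
have sq z z1 : D z = Some z1 -> Psi_letter z 1 != 0 ->
    (nth 0 z1 0 = 2 -> nth 0 z 0 = nth 0 z 1) /\ Psi_letter z 1 = nth 0 z1 0.
  move=> hz; rewrite (Psi_letter_1 hz); case: ifP => // /negbT.
  rewrite negb_and negbK => h _; split=> // e.
  by move: h; rewrite e /= => /eqP.
have [hl1 el] := sq _ _ hD (hl 1 isT); have [hr1 er] := sq _ _ hDr (hr 1 isT).
have [||V /andP[hV sV] e] := IH w1 hw1 d0.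
- by case=> [|i] hi; rewrite -?(Psi_letter_S _ hD) ?hl // -[Psi_letter _ 0]el hl.
- by case=> [|i] hi; rewrite -?(Psi_letter_S _ hDr) ?hr // -[Psi_letter _ 0]er hr.
have x0 : letter (head 0 w).
  have := size_gt1_D hD w10; case: (w) hw => // x t [/andP[hx _] _] _.
  exact: hx.
exists (head 0 w :: V); first by rewrite over_Sigma_cons x0 hV /= eqSS.
rewrite /= -e; apply: (prim_tight _ hD w10); first exact: Cinf_Sigma.
  by rewrite -nth0.
by rewrite -head_rev -nth0.
Qed.

(** The lift of a suffix is a suffix of the lift; where it starts depends on [a] and [h] only, hence
    [a'] and [t] are chosen before [s]. *)
Lemma prim_suffix x a h : letter x -> over_Sigma a -> letter h ->
  exists a' t, [/\ over_Sigma a', letter t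
    & forall s, prim x (a ++ h :: s) = a' ++ prim t (h :: s)].
Proof.
move=> hx; case/lastP: a => [|a c] ha hh; first by exists [::], x.
set a1 := nseq (head 0 (rcons a c) == 1) 1 ++ a.
set r := iter (size a1) (subn 3) x; have hr : letter r by apply: letter_iter.
have hc : letter c by move: ha; rewrite -cats1 over_Sigma_cat => /andP[_ /andP[]].
have e s : prim x (rcons a c ++ h :: s) =
    expand x a1 ++ nseq c r ++ expand (3 - r) ((h :: s) ++ nseq (last 0 (h :: s) == 1) 1).
  rewrite -[nseq c r ++ _]/(expand r (c :: (h :: s) ++ nseq (last 0 (h :: s) == 1) 1)).
  rewrite -expand_cat /prim /pad /a1.
  have -> : head 0 (rcons a c ++ h :: s) = head 0 (rcons a c) by case: (a).
  by rewrite last_cat -cats1 -!catA.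
case/orP: hh e => /eqP-> e.
  (* For [h = 1] the shielding run of length 1 is the last letter of the preceding run, hence
     [c.-1]. *)
  exists (expand x a1 ++ nseq c.-1 r), r; split=> // [|s].
    by rewrite over_Sigma_cat over_Sigma_expand //; apply/allP=> y /nseqP[-> _].
  rewrite e -catA; congr (_ ++ _).
  by case/orP: hc => /eqP->.
(* For [h = 2] there is no shield, and the suffix starts with the run coming from [h]. *)
exists (expand x a1 ++ nseq c r), (3 - r); split=> [||s]; last by rewrite e -catA.
  by rewrite over_Sigma_cat over_Sigma_expand //; apply/allP=> y /nseqP[-> _].
exact: letter_flip.
Qed.

Lemma prims_suffix V a h : over_Sigma V -> over_Sigma a -> letter h ->
  exists a' V', [/\ over_Sigma a', over_Sigma V', size V' = size V
    & forall s, Cinf (h :: s) -> prims V (a ++ h :: s) = a' ++ prims V' (h :: s)].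
Proof.
elim: V => [|x V IH] hV ha hh; first by exists a, [::].
case/andP: hV => hx /IH/(_ ha hh)[a1 [V1 [ha1 hV1 sV1 e1]]].
(* The lifted suffix begins with the first letter of [V1], or with [h] if [V1] is empty: a letter
   independent of [s], as [prim_suffix] requires. *)
have hh1 : letter (head h V1) by case: (V1) hV1 => //= y t /andP[].
have [a' [t [ha' ht e']]] := prim_suffix hx ha1 hh1.
exists a', (t :: V1); split=> //; [by rewrite over_Sigma_cons ht | by rewrite /= sV1 |].
move=> s hs /=; rewrite e1 //.
suff -> : prims V1 (h :: s) = head h V1 :: behead (prims V1 (h :: s)) by [].
case: (V1) hV1 => //= y V2 /andP[hy hV2].
have [h1 h2 _ _ _] := primsP hV2 hs isT.
have := head_prim hy (Cinf_Sigma h1) h2; have := prim_neq0 hy (Cinf_Sigma h1) h2.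
by case: (prim y _) => //= z t' _ ->.
Qed.

(** * Minimal words, their roots and their frontiers *)

Lemma minimal_prims V v : over_Sigma V -> Cinf v -> height v = 1 -> minimal (prims V v).
Proof.
move=> hV hv v1; have v0 : v != [::] by rewrite -[v]/(Dw 0 v) -height_ltn // v1.
elim: V hV => [|x V IH] hV; first by split; rewrite //= v1.
have [h1 _ _ _ h2] := primsP hV hv v0.
case/andP: hV => hx hV; have [h3 h4 _ _ h5] := primsP hV hv v0.
have [_ _ h6] := IH hV.
have hD := D_prim hx (Cinf_Sigma h3) h4.
split=> //; first by rewrite h2 v1 addn1.
case=> [|j] hj.
  rewrite (Dw_S _ hD); split; first by split; [apply: Cinf_Sigma | ].
  by move=> p [_ hp]; apply: size_prim_leq hp h4.
rewrite !(Dw_S _ hD); apply: h6.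
by move: hj; rewrite h2 h5 /= addSn ltnS.
Qed.

Lemma minimalE w : minimal w ->
  [/\ Cinf (root_word w), height (root_word w) = 1 &
   exists2 V, over_Sigma V & w = prims V (root_word w)].
Proof.
move: {2}(height w) (leqnn (height w)) => n; elim: n w => [|n IH] w hn [hw h0 hm].
  by move: h0; rewrite ltnNge hn.
case: (ltnP 1 (height w)) => h1; last first.
  have e : height w = 1 by apply/eqP; rewrite eqn_leq h1.
  by rewrite /root_word e; split=> //; exists [::].
have hD := Cinf_D hw; set v := Dw 1 w in hD.
have w0 : w != [::] by rewrite -[w]/(Dw 0 w) -height_ltn.
have v0 : v != [::] by rewrite -height_ltn.
have hv : Cinf v by apply: Cinf_Dw.
have eh := height_S hw hD w0; rewrite eh !ltnS in hn h1.
have er : root_word w = root_word v.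
  by rewrite /root_word eh /=; case: (height v) h1 => // k _; rewrite (Dw_S _ hD).
have [|r1 r2 [V hV e]] := IH v hn.
  split=> // j hj; have := hm j.+1; rewrite eh ltnS => /(_ hj).
  by rewrite !(Dw_S _ hD).
rewrite er; split=> //; exists (head 0 w :: V).
  rewrite over_Sigma_cons hV andbT.
  by case: (w) w0 hw => // x t _ [/andP[]].
rewrite /= -e; have [|_ hs] := hm 0; first by rewrite eh ltnS.
apply: (prim_shortest (Cinf_Sigma hw) hD v0).
(* Either first letter would do for the competitor, as the length of [prim] depends on the run
   lengths alone. *)
apply: (hs (prim 1 v)); split; first exact: over_Sigma_expand.
exact: D_prim (Cinf_Sigma hv) v0.
Qed.

Lemma Cinf_letter x : letter x -> Cinf [:: x].
Proof.
move=> hx; apply: (@Cinf_S _ [::]) Cinf_nil; first by rewrite over_Sigma_cons hx.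
by [].
Qed.

Lemma Cinf_pair x : letter x -> Cinf [:: x; 3 - x].
Proof.
move=> hx; apply: (@Cinf_S _ [::]) Cinf_nil; first by case/orP: hx => /eqP->.
by case/orP: hx => /eqP->.
Qed.

Lemma root_word_prims V v : over_Sigma V -> Cinf v -> height v = 1 ->
  root_word (prims V v) = v.
Proof.
move=> hV hv v1; have v0 : v != [::] by rewrite -[v]/(Dw 0 v) -height_ltn // v1.
by have [_ _ e _ e'] := primsP hV hv v0; rewrite /root_word e' v1 addn1.
Qed.

Lemma single_rootedE w : single_rooted w -> minimal w ->
  exists V x, [/\ over_Sigma V, letter x & w = prims V [:: x]].
Proof.
case=> _ _ s1 /minimalE[hr _ [V hV e]]; exists V; rewrite e.
case: (root_word w) hr s1 => // x [|//] [/andP[hx _] _] _.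
by exists x.
Qed.

Lemma prims_single V x : over_Sigma V -> letter x ->
  [/\ single_rooted (prims V [:: x]), minimal (prims V [:: x]),
      Psi (prims V [:: x]) = rcons V x & height (prims V [:: x]) = (size V).+1].
Proof.
move=> hV hx; have hC := Cinf_letter hx.
have h1 : height [:: x] = 1 by case/orP: hx => /eqP->.
have [h2 h3 h4 h5 h6] := primsP hV hC isT.
split; [split=> // | exact: minimal_prims | | ].
- by rewrite h6 h1 addn1.
- by rewrite root_word_prims.
- by rewrite h5 -cats1; congr (_ ++ _); case/orP: hx => /eqP->.
by rewrite h6 h1 addn1.
Qed.

(** Uniqueness holds because every single-rooted minimal word is some [prims V' [:: x']], and its
    frontier determines [V'] and [x']. *)
Lemma is_single_prims V x : over_Sigma V -> letter x ->
  is_single_minimal (rcons V x) (prims V [:: x]).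
Proof.
move=> hV hx; have [h1 h2 h3 _] := prims_single hV hx; split=> // w [hs hm].
have [V' [x' [hV' hx' ->]]] := single_rootedE hs hm.
by have [_ _ -> _] := prims_single hV' hx' => /rcons_inj[-> ->].
Qed.

Lemma is_double_prims V x : over_Sigma V -> letter x ->
  is_double_minimal (rcons V x) (prims V [:: x; 3 - x]).
Proof.
move=> hV hx.
have hC y : letter y -> height [:: y; 3 - y] = 1 /\ Psi [:: y; 3 - y] = [:: y].
  by case/orP=> /eqP->.
have P U y : over_Sigma U -> letter y -> Psi (prims U [:: y; 3 - y]) = rcons U y.
  move=> hU hy; have [_ _ _ -> _] := primsP hU (Cinf_pair hy) isT.
  by rewrite (hC y hy).2 cats1.
have [h1 _ _ _ h2] := primsP hV (Cinf_pair hx) isT; have [h3 h4] := hC x hx.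
split.
  split; [split=> // | exact: minimal_prims (Cinf_pair hx) h3 | exact: P].
    by rewrite h2 h3 addn1.
  by rewrite root_word_prims //; apply: Cinf_pair.
move=> w [[_ _ s2] /minimalE[hr r1 [V' hV' e]]].
have [y hy er] : exists2 y, letter y & root_word w = [:: y; 3 - y].
  case: (root_word w) s2 hr r1 => [|y [|z [|]]] // _ [/and3P[hy hz _] _].
  (* A repeated letter has derivative 2, hence height 2, and is not a root. *)
  move: hy hz; do 2![case/orP=> /eqP->] => // h.
  - by exists 1.
  - by exists 2.
by rewrite e er P // => /rcons_inj[-> ->].
Qed.

(** * Zeros in frontiers, factors of full height and the 0-extension *)

Lemma height_rev w : Cinf w -> height (rev w) = height w.
Proof.
move=> hw; have [hr e] := Cinf_rev hw; apply: height_eq => // j.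
by rewrite height_ltn // e -!size_eq0 size_rev.
Qed.

Lemma nth_Sigma_neq0 s i : over_Sigma s -> i < size s -> nth 0 s i != 0.
Proof. by move=> /allP hs hi; case/orP: (hs _ (mem_nth 0 hi)) => /eqP->. Qed.

(** The derivative begins with 2 while the first two letters differ, so a run of length 1 precedes
    the run counted by this 2. *)
Lemma Psi_letter_zero z : Cinf z -> Psi_letter z 1 = 0 -> Dw 1 z != [::] ->
  prefix [:: head 0 z; 3 - head 0 z; 3 - head 0 z] z.
Proof.
move=> hz h0 d0; have hD := Cinf_D hz; set z1 := Dw 1 z in d0 hD.
have hz0 : letter (head 0 z).
  by have := size_gt1_D hD d0; case: (z) hz => // x t [/andP[]].
have h1 : (nth 0 z1 0 == 2) && (nth 0 z 0 != nth 0 z 1).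
  (* The other source of a 0, the default value of [nth], is excluded because [z1] is nonempty. *)
  move: h0; rewrite (Psi_letter_1 hD); case: ifP => // _ e.
  have := @nth_Sigma_neq0 z1 0 (over_Sigma_D hD); rewrite e eqxx.
  by case: (z1) d0 => // c t _ /(_ isT).
case/andP: h1 => /eqP e2; have [a [b [eD _ _]]] := D_inv hD d0.
rewrite nth0 in e2; have := DeltaK (Cinf_Sigma hz); rewrite eD (head_pad e2).
move: (head 0 z) => c <-; case: a {eD} => /=; last by rewrite eqxx.
by rewrite !eqxx ?prefix0s.
Qed.

(* A factor with the same height as [w] starts with the left end of a minimal
   word and, like every suffix of [w], ends with the right end of one; these two
   conditions force the whole suffix [drop i w] to be minimal. *)
Lemma minimal_factor_suffix w i m : Cinf w -> size (root_word w) = 1 ->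
  over_Sigma (Psi (rev w)) -> minimal_factor_at w i m ->
  m = drop i w /\ Psi (rev m) = Psi (rev w).
Proof.
move=> hw sw hS [m1 m2 mh hp].
have [P [r [hP hr em]]] := single_rootedE m1 m2.
have [_ _ eP hP1] := prims_single hP hr; rewrite -em in eP hP1.
rewrite hP1 in mh; rewrite /root_word -mh /= in sw.
set n := size P in mh sw; set v := drop i w in hp *.
have hrv : prefix (rev v) (rev w) by rewrite prefix_rev suffix_drop.
have [hrw erw] := Cinf_rev hw; have [hCrv prv] := Cinf_prefix hrw hrv.
have [hv erv] := Cinf_rev hCrv; rewrite revK in hv erv.
have [hm pm] := Cinf_prefix hv hp.
have m0 j : j <= n -> Dw j m != [::] by move=> hj; rewrite -height_ltn // hP1 ltnS.
have v0 j : j <= n -> Dw j v != [::].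
  by move=> /m0; case/prefixP: (pm j) => q ->; case: (Dw j m).
have rv0 j : j <= n -> Dw j (rev v) != [::].
  by move=> /v0; rewrite erv -!size_eq0 size_rev.
(* Level [n] is that of the root of [w]; by reversal, the derivative of the suffix [v] is a suffix
   of this one-letter root. *)
have sv : size (Dw n v) <= 1.
  by rewrite -sw -(size_rev (Dw n w)) -erw erv size_rev size_prefix // prv.
(* The left frontier of [v] is controlled by [m], the right one by [w]. *)
have [||V /andP[hV /eqP sV] e] := prims_tight hv (v0 n (leqnn n)).
- move=> j hj; rewrite -(Psi_letter_prefix hv hp) ?m0 // -nth_Psi ?hP1 ?ltnS // eP.
  by apply: nth_Sigma_neq0; rewrite ?size_rcons ?ltnS // -cats1 over_Sigma_cat hP /= andbT.
- move=> j hj; rewrite (Psi_letter_prefix hrw hrv) ?rv0 // -nth_Psi ?height_rev -?mh ?ltnS //.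
  by apply: nth_Sigma_neq0; rewrite // size_Psi height_rev // -mh ltnS.
have [x hx ex] : exists2 x, letter x & Dw n v = [:: x].
  have := v0 n (leqnn n); have := Cinf_Sigma (Cinf_Dw n hv).
  by case: (Dw n v) sv => // x [|] // _ /andP[hx _] _; exists x.
rewrite ex in e; have [_ _ ev hev] := prims_single hV hx; rewrite -e sV in ev hev.
have emv : m = v.
  have := Psi_prefix hv hp; rewrite hP1 hev eP ev => /(_ erefl)/rcons_inj[eP' er].
  by rewrite em e eP' er.
split=> //; rewrite emv; apply: Psi_prefix => //.
by rewrite !height_rev // hev mh.
Qed.

(** The 0 forces the derivative of order [size V] to begin with [x] followed by two copies of
    [3 - x]; lifting this, every word with the given frontier has the displayed one as a prefix. *)
Lemma is_shortest_prims V x : over_Sigma V -> letter x ->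
  is_shortest (rcons (rcons V x) 0) (prims V [:: x; 3 - x; 3 - x]).
Proof.
move=> hV hx.
have hC : Cinf [:: x; 3 - x; 3 - x].
  apply: (@Cinf_S _ [:: 2]); last exact: Cinf_letter.
    by rewrite !over_Sigma_cons hx letter_flip.
  by case/orP: hx => /eqP->.
have [h1 _ _ h2 _] := primsP hV hC isT.
have hP : Psi (prims V [:: x; 3 - x; 3 - x]) = rcons (rcons V x) 0.
  by rewrite h2 -!cats1 -catA; congr (_ ++ _); case/orP: hx => /eqP->.
have hpre w : Cinf w -> Psi w = rcons (rcons V x) 0 ->
    prefix (prims V [:: x; 3 - x; 3 - x]) w.
  move=> hw eP; have hh : height w = (size V).+2 by rewrite -size_Psi eP !size_rcons.
  have hl j : j <= (size V).+1 -> Psi_letter w j = nth 0 (rcons (rcons V x) 0) j.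
    by move=> hj; rewrite -eP nth_Psi // hh.
  have lV : Psi_letter w (size V) = x.
    by rewrite hl // nth_rcons size_rcons ltnSn nth_rcons ltnn eqxx.
  have x0 : x != 0 by case/orP: hx => /eqP->.
  have hz := Cinf_Dw (size V) hw; set z := Dw (size V) w in hz.
  have ez : head 0 z = x.
    move: lV; rewrite /z; case: (size V) => [|j] //=; case: ifP => // _ e.
    by rewrite -e in x0.
  apply: prims_prefix => //; last by rewrite lV.
    rewrite -/z -ez; apply: Psi_letter_zero => //.
      by rewrite Psi_letter_Dw // add0n hl // nth_rcons size_rcons ltnn eqxx.
    by rewrite -Dw_add // add1n -height_ltn // hh.
  move=> j hj; rewrite hl; last by rewrite ltnW // ltnS ltnW.
  by rewrite nth_rcons size_rcons ltnS ltnW // nth_rcons hj.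
split; first by split=> // w hw /(hpre w hw)/size_prefix.
move=> w [hw eP hs]; have := hs _ h1 hP; case/prefixP: (hpre w hw eP) => q ->.
by rewrite size_cat -{2}(addn0 (size _)) leq_add2l leqn0 size_eq0 => /eqP->; rewrite cats0.
Qed.

Theorem theorem5 (k : nat) (u U : word)
    (k_gt0 : 0 < k)
    (u_single : single_rooted u) (u_minimal : minimal u) (u_height : height u = k)
    (U_Sigma : over_Sigma U) (U_size : size U = k) (U_frontier : Psi u = U) :
  exists u1 u2 u0 : word,
    [/\ (* the right 1-, 2- and 0-extensions of u *)
        [/\ is_single_minimal (rcons U 1) u1,
            is_single_minimal (rcons U 2) u2
          & is_shortest (rcons U 0) u0],
        [/\ Cinf u1, Cinf u2 & Cinf u0],
        [/\ height u1 = k.+1, height u2 = k.+1 & height u0 = k.+1],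
        [/\ prefix u u1, prefix u u2 & prefix u u0]
      & [/\ single_rooted u0, ~ minimal u0
          & exists T m : word,
              [/\ is_Theta U T, is_single_minimal (rcons T 2) m
                & is_minimal_part u0 m]]].
Proof.
have [V [x [hV hx eu]]] := single_rootedE u_single u_minimal.
have [_ _ eU hu] := prims_single hV hx.
rewrite -eu U_frontier in eU; rewrite -eu u_height in hu.
rewrite eU in U_Sigma *; rewrite eu hu {u U k k_gt0 u_single u_minimal u_height
  U_size U_frontier eU eu hu}.
set y := 3 - x; have hy : letter y := letter_flip hx.
set u0 := prims V [:: x; y; y].
have ext c : letter c -> prefix (prims V [:: x]) (prims (rcons V x) [:: c]).
  (* The last frontier letter of [u] now chooses a primitive of [[:: c]], whose first letter is the
     root [x] of [u]. *)
  move=> hc; rewrite [prims (rcons V x) _]/prims foldr_rcons.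
  apply: prims_mono => //; first exact: Cinf_prim (Cinf_letter hc) isT.
  by case/orP: hc => /eqP->; rewrite /prim /= eqxx ?prefix0s.
have [[[s1C _ _] _ _ h1] [[s2C _ _] _ _ h2]] :=
  (prims_single U_Sigma (isT : letter 1), prims_single U_Sigma (isT : letter 2)).
have C0 : Cinf [:: x; y; y].
  apply: (@Cinf_S _ [:: 2]); last exact: Cinf_letter.
    by rewrite !over_Sigma_cons hx hy.
  by rewrite /y; case/orP: hx => /eqP->.
have hh0 : height [:: x; y; y] = 2 by rewrite /y; case/orP: hx => /eqP->.
have [u0C u00 u0D u0P u0h] := primsP hV C0 isT; rewrite -/u0 hh0 addn2 in u0C u00 u0D u0P u0h.
have u0root : root_word u0 = [:: 2].
  rewrite /root_word u0h /= -add1n Dw_add // u0D /y.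
  by case/orP: hx => /eqP->.
have u0S := is_shortest_prims hV hx; rewrite -/y -/u0 in u0S.
have u0single : single_rooted u0 by split; rewrite ?u0root ?u0h.
have u0min : ~ minimal u0.
  (* The frontier of a minimal single-rooted word ends in the letter of its root, whereas that of
     [u0] ends in 0. *)
  move=> /(single_rootedE u0single)[W [c [hW hc e]]].
  have [_ _ eP _] := prims_single hW hc; case: u0S => -[_ e' _] _.
  by move: eP hc; rewrite -e e' => /rcons_inj[_ <-].
have hxS : over_Sigma [:: x] by rewrite over_Sigma_cons hx.
(* The same [a] and [V2] serve for the suffix [yy] of [xyy] and for the suffix [y] of the double
   root [xy]. *)
have [a [V2 [_ hV2 sV2 e2]]] := prims_suffix hV hxS hy.
have TS : over_Sigma (rcons V2 y) by rewrite -cats1 over_Sigma_cat hV2 /= andbT.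
set m := prims (rcons V2 y) [:: 2].
have u0m : u0 = a ++ m.
  have hyy : Cinf [:: y; y].
    apply: (@Cinf_S _ [:: 2]); last exact: Cinf_letter.
      by rewrite !over_Sigma_cons hy.
    by case/orP: hy => /eqP->.
  by rewrite /m /prims foldr_rcons /u0 -[[:: x; y; y]]/([:: x] ++ [:: y; y]) e2.
have [m1 m2 mP mh] := prims_single TS (isT : letter 2).
rewrite -/m in m1 m2 mP mh; rewrite size_rcons in mh.
have ma : minimal_factor_at u0 (size a) m.
  split=> //; first by rewrite mh u0h sV2.
  by rewrite /occurs_at u0m drop_size_cat // prefix_refl.
(* The reversed top word [yyx] has frontier [y2]: its first two letters agree. *)
have u0R : over_Sigma (Psi (rev u0)).
  have [R /andP[hR _] ->] := rev_prims [:: x; y; y] hV.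
  have hC : Cinf [:: y; y; x] by have [] := Cinf_rev C0.
  have [_ _ _ -> _] := primsP hR hC isT.
  by rewrite over_Sigma_cat hR /y; case/orP: hx => /eqP->.
have u0f i w := @minimal_factor_suffix u0 i w u0C (congr1 size u0root) u0R.
exists (prims (rcons V x) [:: 1]), (prims (rcons V x) [:: 2]), u0.
split; first by split=> //; apply: is_single_prims.
- by [].
- by rewrite h1 h2 u0h size_rcons.
- split; [exact: ext | exact: ext | apply: prims_mono => //].
  by rewrite /= eqxx ?prefix0s.
split=> //; exists (rcons V2 y), m; split; last first.
- have hlast i w : minimal_factor_at u0 i w -> w = m /\ i = size a.
    move=> hi; have [ew eP] := u0f _ _ hi; have [_ eP'] := u0f _ _ ma.
    have ewm : w = m.
      have [w1 w2 _ _] := hi.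
      have [W [c [hW hc e]]] := single_rootedE w1 w2.
      (* The reversals are single-rooted minimal words too, so the common right frontier identifies
         [w] with [m]. *)
      apply: (can_inj revK).
      have [W' /andP[hW' _] eW'] := rev_prims [:: c] hW.
      have [W2 /andP[hW2 _] eW2] := rev_prims [:: 2] TS.
      have [_ _ eQ _] := prims_single hW' hc.
      have [_ _ eQ2 _] := prims_single hW2 (isT : letter 2).
      move: eP; rewrite -eP' e /m eW' eW2 eQ eQ2 => /rcons_inj[-> ->].
      by [].
    split=> //; rewrite ewm in ew; have := congr1 size ew.
    (* Nonemptiness of [m] rules out truncation in the subtraction given by [size_drop]. *)
    have m0 : 0 < size m by rewrite lt0n size_eq0 -[m]/(Dw 0 m) -height_ltn ?mh //; case: m1.
    rewrite size_drop u0m size_cat => es; apply/eqP.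
    have hi' : i <= size a + size m by rewrite ltnW // -subn_gt0 -es.
    by rewrite -(eqn_add2r (size m)) {1}es subnKC.
  split; first by exists (size a) => // j w /hlast[_ ->].
  by move=> w [i /hlast[]].
- exact: is_single_prims.
have dE : prims V [:: x; y] = a ++ prims V2 [:: y].
  by rewrite -[[:: x; y]]/([:: x] ++ [:: y]) e2 //; apply: Cinf_letter.
have dC : Cinf (prims V [:: x; y]) /\ height (prims V [:: x; y]) = (size V).+1.
  have [? _ _ _ ->] := primsP hV (Cinf_pair hx) isT; split=> //.
  by rewrite /y; case/orP: hx => /eqP->; rewrite addn1.
case: dC => dC dh.
have [V3 /andP[hV3 /eqP sV3] e3] := rev_prims [:: y] hV2.
have [_ _ P3 h3] := prims_single hV3 hy.
exists (Psi (rev (prims V [:: x; y]))).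
  by exists (prims V [:: x; y]) => //; apply: is_double_prims.
(* This is the reversal of [prims V2 [:: y]], so its right frontier is [rcons V2 y]. *)
exists (prims V3 [:: y]); last first.
  by rewrite -[prims V3 _]e3 revK; have [_ _ -> _] := prims_single hV2 hy.
(* It is a prefix, of the same height, of the reversed double-rooted word, so the two left frontiers
   coincide. *)
rewrite -(@Psi_prefix _ (prims V3 [:: y])); first by rewrite P3; apply: is_single_prims.
- by case: (Cinf_rev dC).
- by rewrite -[prims V3 _]e3 dE prefix_rev suffix_suffix.
by rewrite h3 height_rev // dh sV3 sV2.
Qed.
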